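(* Let $E\subseteq[3]^4$ be a set of (distinct) clauses, let $A$ be its clause-by-player-question incidence matrix, and let $c\in\ker_{\mathbb Z}(A^{\mathsf T})$ be a primitive support-minimal circuit. Then there exists a balanced word $w_c$ that uses each clause $e\in E$ exactly $|c_e|$ times and whose alternating vector satisfies $y(w_c)=c$ or $y(w_c)=-c$. In particular, $\pi(w_c)=c\bmod 2$.
   Context: $[3]=\{1,2,3\}$. A clause $e\in E\subseteq[3]^4$ is a tuple $(q_e^{(1)},\dots,q_e^{(4)})$; coordinate $\alpha$ is the question of player $\alpha$. The incidence matrix $A$ has rows indexed by $E$ and columns by pairs $(\alpha,j)$, $1\le\alpha\le4$, $j\in[3]$, with $A_{e,(\alpha,j)}=1$ if $q_e^{(\alpha)}=j$ and $0$ otherwise. A primitive support-minimal circuit is a nonzero $c\in\ker_{\mathbb Z}(A^{\mathsf T})\subseteq\mathbb Z^E$ such that no nonzero element of $\ker_{\mathbb Z}(A^{\mathsf T})$ has support strictly contained in $\operatorname{supp}c=\{e:c_e\ne0\}$, and whose nonzero coordinates have greatest common divisor one. A clause word $w=e_1\cdots e_N$ is a finite sequence of elements of $E$. It is balanced if for each player $\alpha$ the projected word $q_{e_1}^{(\alpha)}\cdots q_{e_N}^{(\alpha)}$, viewed as a word in involutive letters (one generator of order two per question, no other relations), freely reduces to the identity, i.e. can be reduced to the empty word by repeatedly deleting adjacent equal letters. The alternating vector of $w$ is $y(w)\in\mathbb Z^E$, $y(w)_e=\sum_{\{t:e_t=e\}}(-1)^{t-1}$. The vector $\pi(w)\in\mathbb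 F_2^E$ records the parity of the number of occurrences of each clause in $w$. *)

(* Defs.v *)
From HB Require Import structures.
From mathcomp Require Import all_boot all_order all_algebra.

Set Implicit Arguments.
Unset Strict Implicit.
Unset Printing Implicit Defensive.

Import GRing.Theory.
Local Open Scope ring_scope.

(* Players are 'I_4; the questions 1, 2, 3 of each player are the elements
   0, 1, 2 of 'I_3. *)
Definition clause : finType := 4.-tuple 'I_3.

Definition question (e : clause) (alpha : 'I_4) : 'I_3 := tnth e alpha.

Definition column : finType := ('I_4 * 'I_3)%type.

Section Clauses.
Variable E : {set clause}.

Definition clause_in : finType := {e : clause | e \in E}.

(* Matrices are indexed by ordinals, so rows and columns are numbered through
   enum_val. *)
Definition incidence : 'M[int]_(#|clause_in|, #|column|) :=
  \matrix_(i, k) (question (val (enum_val i)) (enum_val k).1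
                    == (enum_val k).2)%:R.

Definition in_kerT (c : {ffun clause_in -> int}) : Prop :=
  incidence^T *m (\col_i c (enum_val i)) = 0.

Definition primitive_circuit (c : {ffun clause_in -> int}) : Prop :=
  [/\ in_kerT c,
      c != 0,
      forall d : {ffun clause_in -> int},
        in_kerT d -> d != 0 -> ~~ (support d \proper support c)
    & \big[gcdn/0%N]_(e | c e != 0) `|c e|%N = 1%N].

Definition projection (w : seq clause_in) (alpha : 'I_4) : seq 'I_3 :=
  [seq question (val e) alpha | e <- w].

(* Positions are numbered from 0 here, hence the exponent t instead of t - 1. *)
Definition alternating (w : seq clause_in) : {ffun clause_in -> int} :=
  [ffun e => \sum_(t < size w | tnth (in_tuple w) t == e) (-1) ^+ t].

Definition parity_vector (w : seq clause_in) : {ffun clause_in -> 'F_2} :=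
  [ffun e => (count_mem e w)%:R].

Definition mod2 (c : {ffun clause_in -> int}) : {ffun clause_in -> 'F_2} :=
  [ffun e => (c e)%:~R].

End Clauses.

Inductive reduces_to_nil (T : Type) : seq T -> Prop :=
| reduces_nil : reduces_to_nil [::]
| reduces_delete (u v : seq T) (x : T) :
    reduces_to_nil (u ++ v) -> reduces_to_nil (u ++ [:: x; x] ++ v).

Definition balanced (E : {set clause}) (w : seq (clause_in E)) : Prop :=
  forall alpha : 'I_4, reduces_to_nil (projection w alpha).

(* Main.v *)
(* Only the equality of the marginals of the positive and negative parts of [c]
   is used: any two multisets [A] and [B] of clauses in which every player sees
   the same questions equally often can be interleaved, [A] in the even
   positions and [B] in the odd ones, into a balanced word.

   The proof is by induction on the size. Suppose that [X] in [A] and [Y] in [B]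
   have [k + 1] and [k] elements, [k] being 1 or 2, and that for each player the
   questions of [Y] occur among those of [X]. Then [X] and [Y] can be arranged
   into an alternating word that reduces to a single letter for each player. For
   [k = 2] this holds because each player rules out at most one of the six
   orders of [X], and there are only four players. The four letters left form a
   clause [x], and a balanced word for [A - X + x] and [B - Y] yields one for
   [A] and [B].

   It remains to see that two disjoint nonempty multisets with the same
   marginals always contain such [X] and [Y], up to exchanging their roles. This
   is a finite search over the supports of [A] and [B]. It branches on linear
   inequalities: a weight on the pairs (player, question) has the same average
   over [A] and over [B], so that if it separates the elements known to be in
   [A] from those known to be in [B], then some other element violates the
   separation. *)

Require Import Defs.
From HB Require Import structures.
From Stdlib Require Import Classical.
From mathcomp Require Import all_boot all_order all_algebra all_fingroup.
From mathcomp Require Import zify.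

Set Implicit Arguments.
Unset Strict Implicit.
Unset Printing Implicit Defensive.

Import GRing.Theory.

(** * Alternating words and their reductions *)

Section Words.
Variable T : eqType.
Implicit Types (s u v w l : seq T) (x y z : T) (b : bool).

Fixpoint alternate b s : seq T :=
  if s is x :: s' then
    if b then x :: alternate (~~ b) s' else alternate (~~ b) s'
  else [::].

Lemma alternate_cat b u v :
  alternate b (u ++ v) = alternate b u ++ alternate (b (+) odd (size u)) v.
Proof.
elim: u b => [|x u IHu] b; first by rewrite addbF.
by case: b; rewrite /= IHu; case: (odd _).
Qed.

Lemma count_alternate (P : pred T) s :
  count P s = count P (alternate true s) + count P (alternate false s).
Proof. by elim: s => //= x s ->; rewrite -addnA; congr addn; rewrite addnC. Qed.

Lemma alternate_rev b s :
  ~~ odd (size s) -> perm_eq (alternate b (rev s)) (alternate (~~ b) s).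
Proof.
have rev_alternate c s' :
    perm_eq (alternate c (rev s')) (alternate (c (+) ~~ odd (size s')) s').
  elim: s' c => [//|x s' IHs] c.
  rewrite rev_cons -cats1 alternate_cat size_rev perm_catC /= negbK.
  move: (IHs c); rewrite addbN.
  by case: (c (+) odd (size s')); rewrite /= ?perm_cons.
by move=> even_s; rewrite (perm_trans (rev_alternate _ _)) // even_s addbT.
Qed.

Lemma split_alternate b x s :
  x \in alternate b s -> exists u v, s = u ++ x :: v /\ odd (size u) = ~~ b.
Proof.
elim: s b => [//|y s IHs] [] /=.
  rewrite inE => /predU1P[->|/IHs[u [v [-> ou]]]]; first by exists [::], s.
  by exists (y :: u), v; rewrite /= ou.
by move=> /IHs[u [v [-> ou]]]; exists (y :: u), v; rewrite /= ou.
Qed.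

Lemma reduces_odd s : reduces_to_nil s -> ~~ odd (size s).
Proof. by elim=> // u v x _; rewrite !size_cat /= !addnS /= negbK. Qed.

Lemma reduces_rev s : reduces_to_nil s -> reduces_to_nil (rev s).
Proof.
elim=> [|u v x _]; first exact: reduces_nil.
rewrite !rev_cat -catA; exact: reduces_delete.
Qed.

(** A contextual form of the statement that [l] reduces to [z], which refers only to reductions to
    the empty word. *)
Definition collapses l z :=
  forall u v, reduces_to_nil (u ++ z :: v) -> reduces_to_nil (u ++ l ++ v).

Lemma insert_pair u v x :
  reduces_to_nil (u ++ v) -> reduces_to_nil (u ++ x :: x :: v).
Proof. exact: reduces_delete. Qed.

Lemma collapses3 x1 x2 y :
  (y == x1) || (y == x2) ->
  exists z, collapses [:: x1; y; x2] z /\ perm_eq [:: x1; x2] [:: z; y].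
Proof.
case/orP=> /eqP->.
  exists x2; split=> [u v|]; first exact: insert_pair.
  by apply/seq.permP => P /=; lia.
exists x1; split=> [u v|]; last exact: perm_refl.
by rewrite /= -cat_rcons => /(insert_pair x2); rewrite cat_rcons.
Qed.

(* The non-crossing ways to match [y1] and [y2] within [x1 y1 x2 y2 x3]; the
   only other one matches [y1] with [x3] and [y2] with [x1]. *)
Definition planar x1 x2 x3 y1 y2 :=
  [|| (y1 == x1) && (y2 == x2), (y1 == x1) && (y2 == x3),
      (y1 == x2) && (y2 == x1), (y1 == x2) && (y2 == x3)
    | (y1 == x3) && (y2 == x2)].

Lemma collapses5 x1 x2 x3 y1 y2 :
  planar x1 x2 x3 y1 y2 ->
  exists z, collapses [:: x1; y1; x2; y2; x3] z
    /\ perm_eq [:: x1; x2; x3] [:: z; y1; y2].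
Proof.
case/or4P=> [||| /orP[]] /andP[/eqP-> /eqP->].
- exists x3; split=> [u v /=|]; last by apply/seq.permP => P /=; lia.
  by move=> /(insert_pair x2)/(insert_pair x1).
- exists x2; split=> [u v /=|]; last by apply/seq.permP => P /=; lia.
  rewrite -cat_rcons => /(insert_pair x3); rewrite cat_rcons.
  exact: insert_pair.
- exists x3; split=> [u v /=|]; last by apply/seq.permP => P /=; lia.
  move=> /(insert_pair x1); rewrite -cat_rcons => /(insert_pair x2).
  by rewrite cat_rcons.
- exists x1; split=> [u v /=|]; last exact: perm_refl.
  rewrite -cat_rcons => /(insert_pair x3)/(insert_pair x2).
  by rewrite cat_rcons.
- exists x1; split=> [u v /=|]; last by apply/seq.permP => P /=; lia.
  rewrite -cat_rcons => /(insert_pair x3).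
  by rewrite -cat_rcons => /(insert_pair x2); rewrite !cat_rcons.
Qed.

End Words.

Lemma alternate_map (T U : eqType) (f : T -> U) b s :
  alternate b (map f s) = map f (alternate b s).
Proof. by elim: s b => [//|x s IHs] [] /=; rewrite IHs. Qed.

Lemma reduces_map (T U : Type) (f : T -> U) s :
  reduces_to_nil s -> reduces_to_nil (map f s).
Proof.
elim=> [|u v x _]; first exact: reduces_nil.
by rewrite !map_cat; apply: reduces_delete.
Qed.

Section Fits.
Variable T : eqType.
Implicit Types (s t : seq T) (x y : T) (o : seq nat).

Fixpoint fits s t : bool :=
  if s is x :: s' then (x \in t) && fits s' (rem x t) else true.

Definition orders : seq (seq nat) :=
  [:: [:: 0; 1; 2]; [:: 0; 2; 1]; [:: 1; 0; 2]; [:: 1; 2; 0]; [:: 2; 0; 1];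
      [:: 2; 1; 0]].

Definition planar_order (xs : seq T) y1 y2 o :=
  let x i := nth y1 xs (nth 0 o i) in planar (x 0) (x 1) (x 2) y1 y2.

(** Once [y1] and [y2] are matched with two distinct entries of the triple, the only bad order puts
    the entry of [y1] last and that of [y2] first. Repeated letters can only offer further planar
    matchings. *)
Lemma count_crossing x1 x2 x3 y1 y2 :
  fits [:: y1; y2] [:: x1; x2; x3] ->
  count (predC (planar_order [:: x1; x2; x3] y1 y2)) orders <= 1.
Proof.
have leaf z1 z2 : [|| (z1 == x1) && (z2 == x2), (z1 == x1) && (z2 == x3),
    (z1 == x2) && (z2 == x1), (z1 == x2) && (z2 == x3),
    (z1 == x3) && (z2 == x1) | (z1 == x3) && (z2 == x2)] ->
    count (predC (planar_order [:: x1; x2; x3] z1 z2)) orders <= 1.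
  case/or4P=> [||| /or3P[]] /andP[/eqP-> /eqP->];
    rewrite /planar_order /planar /= !eqxx /= ?orbT /=;
    by do !case: (_ == _).
move=> fit_y; apply: leaf; move: fit_y; rewrite /= !inE andbT.
case: (eqVneq x1 y1) => [->|_] /=.
  by rewrite !inE => /orP[]->; rewrite ?orbT.
case: (eqVneq x2 y1) => [->|_] /=.
  by rewrite !inE => /orP[]->; rewrite ?orbT.
by case: (eqVneq x3 y1) => //= _; rewrite !inE.
Qed.

End Fits.

Lemma rem_map (T U : eqType) (f : T -> U) (x : T) s :
  injective f -> rem (f x) (map f s) = map f (rem x s).
Proof.
by move=> inj_f; elim: s => //= y s ->; rewrite inj_eq //; case: eqP.
Qed.

Lemma fits_map (T U : eqType) (f : T -> U) s t :
  injective f -> fits (map f s) (map f t) = fits s t.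
Proof.
move=> inj_f; elim: s t => //= x s IHs t.
by rewrite mem_map // rem_map // IHs.
Qed.

(** * Realizable pairs and minimal counterexamples *)

Definition track (al : 'I_4) (w : seq clause) : seq 'I_3 :=
  [seq question e al | e <- w].

Definition equimarginal (A B : seq clause) :=
  forall al, perm_eq (track al A) (track al B).

Definition realizable (A B : seq clause) :=
  exists w, [/\ perm_eq (alternate true w) A, perm_eq (alternate false w) B
    & forall al, reduces_to_nil (track al w)].

Lemma equimarginal_size A B : equimarginal A B -> size A = size B.
Proof. by move=> /(_ ord0)/perm_size; rewrite !size_map. Qed.

Lemma equimarginal_sym A B : equimarginal A B -> equimarginal B A.
Proof. by move=> mAB al; rewrite perm_sym. Qed.

Lemma equimarginal_perm A A' B B' :
  perm_eq A A' -> perm_eq B B' -> equimarginal A B -> equimarginal A' B'.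
Proof.
move=> eqA eqB mAB al; rewrite perm_sym in eqA.
exact: perm_trans (perm_map _ eqA) (perm_trans (mAB al) (perm_map _ eqB)).
Qed.

Lemma realizable_perm A A' B B' :
  perm_eq A A' -> perm_eq B B' -> realizable A B -> realizable A' B'.
Proof.
move=> eqA eqB [w [wA wB red_w]].
by exists w; split=> //; [apply: perm_trans eqA | apply: perm_trans eqB].
Qed.

Lemma realizable_sym A B : realizable A B -> realizable B A.
Proof.
move=> [w [wA wB red_w]].
have even_w : ~~ odd (size w).
  by have := reduces_odd (red_w ord0); rewrite size_map.
exists (rev w); split=> [||al].
- exact: perm_trans (alternate_rev true even_w) wB.
- exact: perm_trans (alternate_rev false even_w) wA.
- by rewrite /track map_rev; apply: reduces_rev (red_w al).
Qed.

Lemma realizable_cons x A B : realizable A B -> realizable (x :: A) (x :: B).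
Proof.
move=> [w [wA wB red_w]]; exists (x :: x :: w).
split=> [||al]; rewrite /= ?perm_cons //.
exact: (@insert_pair _ [::] _ _ (red_w al)).
Qed.

(** [x] stands at an even position of the word for [x :: A]. As [l] has odd length, putting it in
    place of [x] keeps the parity of all other positions. *)
Lemma realizable_collapse x l A B :
    odd (size l) -> (forall al, collapses (track al l) (question x al)) ->
    realizable (x :: A) B ->
  realizable (alternate true l ++ A) (alternate false l ++ B).
Proof.
move=> odd_l coll_l [w [wA wB red_w]].
have /split_alternate[u [v [def_w odd_u]]] : x \in alternate true w.
  by rewrite (perm_mem wA) mem_head.
exists (u ++ l ++ v); subst w; move: wA wB.
rewrite !alternate_cat odd_l odd_u /= => wA wB; split.
- rewrite perm_catCA perm_cat2l; move: wA.
  by rewrite -[x :: alternate false v]cat1s perm_catCA perm_cons.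
- by rewrite perm_catCA perm_cat2l.
move=> al; rewrite /track !map_cat; apply: coll_l.
by have := red_w al; rewrite /track map_cat.
Qed.

(* A matching of the two elements of [Y] into the three of [X] is crossing for a
   single one of the six orders of [X], so four players cannot spoil all of
   them. *)
Lemma absorb_word X Y :
    size X = (size Y).+1 -> 0 < size Y <= 2 ->
    (forall al, fits (track al Y) (track al X)) ->
  exists l x, [/\ odd (size l), perm_eq (alternate true l) X,
    perm_eq (alternate false l) Y
    & forall al, collapses (track al l) (question x al)
        /\ perm_eq (track al X) (question x al :: track al Y)].
Proof.
(* The players' remaining letters are chosen independently: any four letters form a clause, which
   need not belong to [E]. *)
have letterwise l X0 : (forall al, exists z, collapses (track al l) z /\
      perm_eq (track al X0) (z :: track al (alternate false l))) ->
    exists x, forall al, collapses (track al l) (question x al)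
      /\ perm_eq (track al X0) (question x al :: track al (alternate false l)).
  case/fin_all_exists=> f fP; exists [tuple f al | al < 4] => al.
  by rewrite /question tnth_mktuple.
case: Y X => [|y1 [|y2 [|//]]] [|x1 [|x2 [|x3 [|//]]]] //= _ _ fitYX.
  case: (letterwise [:: x1; y1; x2] [:: x1; x2]) => [al|x xP].
    apply: collapses3; have := fitYX al.
    by rewrite andbT !inE.
  by exists [:: x1; y1; x2], x.
pose planar_for al :=
  planar_order (track al [:: x1; x2; x3]) (question y1 al) (question y2 al).
have [o o_in planar_o] : exists2 o, o \in orders & forall al, planar_for al o.
  suff: has (fun o => [forall al, planar_for al o]) orders.
    by case/hasP=> o o_in /forallP; exists o.
  rewrite -[has _ _]negbK -all_predC; apply/negP.
  rewrite all_count => /eqP all_bad.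
  (* Union bound: four players with at most one bad order each cannot cover six orders. *)
  have union (s : seq (seq nat)) :
      count (fun o => [exists al, ~~ planar_for al o]) s
      <= \sum_(al < 4) count (predC (planar_for al)) s.
    elim: s => [|o s IHs] /=; first by rewrite big1.
    rewrite big_split leq_add //; case: existsP => //= -[al bad_al].
    by rewrite (bigD1 al) //= bad_al.
  have: 6 <= \sum_(al < 4) count (predC (planar_for al)) orders.
    rewrite -[6]/(size orders) -[size _]all_bad; apply: leq_trans (union _).
    by rewrite (eq_count (a2 := fun o => [exists al, ~~ planar_for al o])).
  apply/negP; rewrite -ltnNge (@leq_ltn_trans (\sum_(al < 4) 1)) //; last first.
    by rewrite sum1_card card_ord.
  by apply: leq_sum => al _; apply: count_crossing; apply: fitYX.
pose x i := nth x1 [:: x1; x2; x3] (nth 0 o i).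
have perm_x : perm_eq [:: x 0; x 1; x 2] [:: x1; x2; x3].
  have : perm_eq [:: nth 0 o 0; nth 0 o 1; nth 0 o 2] [:: 0; 1; 2].
    by move: o_in; rewrite !inE; do 5?[case/predU1P=> [->//|]]; move/eqP->.
  by move/(perm_map (nth x1 [:: x1; x2; x3])).
case: (letterwise [:: x 0; y1; x 1; y2; x 2] [:: x1; x2; x3]) => [al|z zP].
  have tr_x i : i < 3 ->
      nth (question y1 al) (track al [:: x1; x2; x3]) (nth 0 o i)
        = question (x i) al.
    move=> lti; rewrite (nth_map x1) //=.
    move: o_in lti; rewrite !inE.
    by do 5?[case/predU1P=> [->|]]; [..| move/eqP->]; case: i => [|[|[|]]].
  have := planar_o al; rewrite /planar_for /planar_order !tr_x //.
  move=> /collapses5[z [coll_z perm_z]].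
  exists z; split=> //=; apply: perm_trans perm_z.
  by rewrite perm_sym; apply: (perm_map (fun e => question e al) perm_x).
by exists [:: x 0; y1; x 1; y2; x 2], z.
Qed.

Lemma uniq_sub_perm (T : eqType) (X A : seq T) :
  uniq X -> {subset X <= A} -> exists A0, perm_eq A (X ++ A0).
Proof.
elim: X A => [|x X IHX] A /=; first by exists A.
move=> /andP[xX uX] sXA.
have xA : x \in A by apply: sXA; rewrite mem_head.
have [y yX|A0 permA] := IHX (rem x A) uX.
  have := sXA y; rewrite inE yX orbT => /(_ isT).
  rewrite (perm_mem (perm_to_rem xA)) inE => /predU1P[yx|//].
  by rewrite -yx yX in xX.
exists A0; apply: perm_trans (perm_to_rem xA) _.
by rewrite perm_cons.
Qed.

Definition critical (A B : seq clause) :=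
  [/\ equimarginal A B, ~ realizable A B
    & forall A' B', equimarginal A' B' -> size A' < size A -> realizable A' B'].

Lemma critical_sym A B : critical A B -> critical B A.
Proof.
move=> [mAB notAB IH]; split=> [||A' B' mA'B']; first exact: equimarginal_sym.
  by move=> /realizable_sym.
by rewrite -(equimarginal_size mAB); apply: IH.
Qed.

(** Two copies of a common clause can be put in front of a word for the rest, which exists by
    minimality. *)
Lemma critical_disjoint A B x : critical A B -> x \in A -> x \in B -> False.
Proof.
move=> [mAB notAB IH] /perm_to_rem eqA /perm_to_rem eqB; apply: notAB.
rewrite perm_sym in eqA; rewrite perm_sym in eqB.
apply: (realizable_perm eqA eqB); apply: realizable_cons; apply: IH.
  rewrite perm_sym in eqA; rewrite perm_sym in eqB.
  move=> al; have := equimarginal_perm eqA eqB mAB al.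
  by rewrite perm_cons.
by rewrite -(perm_size eqA).
Qed.

(** The pair [x :: A0], [B0] has equal marginals, as [x] and [Y] together have the letters of [X].
    It is smaller because [Y] is nonempty, so it is realizable and the collapse applies. *)
Lemma critical_absorb A B X Y :
    critical A B -> uniq X -> {subset X <= A} -> uniq Y -> {subset Y <= B} ->
    size X = (size Y).+1 -> 0 < size Y <= 2 ->
  ~ forall al, fits (track al Y) (track al X).
Proof.
move=> [mAB notAB IH] uX sXA uY sYB szX szY /(absorb_word szX szY).
have [A0 eqA] := uniq_sub_perm uX sXA; have [B0 eqB] := uniq_sub_perm uY sYB.
move=> [l [x [odd_l lX lY collP]]]; apply: notAB.
apply: (@realizable_perm (alternate true l ++ A0) _ (alternate false l ++ B0)).
- by rewrite perm_sym (perm_trans eqA) // perm_cat2r perm_sym.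
- by rewrite perm_sym (perm_trans eqB) // perm_cat2r perm_sym.
apply: (realizable_collapse (x := x)) => // [al|]; first by case: (collP al).
apply: IH => [al|].
  have := equimarginal_perm eqA eqB mAB al; rewrite /track !map_cat.
  have [_ permX] := collP al.
  have := perm_cat permX (perm_refl (track al A0)); rewrite perm_sym.
  move=> /perm_trans/[apply].
  by rewrite cat_cons -cat1s perm_catCA perm_cat2l.
rewrite (perm_size eqA) size_cat szX /= addSn ltnS -{1}[size A0]add0n ltn_add2r.
by case/andP: szY.
Qed.

(** * Relabelling players and questions *)

Lemma fits_perm (T : eqType) (s t : seq T) :
  fits s t -> size s = size t -> perm_eq s t.
Proof.
elim: s t => [|x s IHs] t /=; first by case: t.
move=> /andP[tx /IHs fit_s] sz_s; rewrite perm_sym.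
apply: perm_trans (perm_to_rem tx) _; rewrite perm_cons perm_sym.
by apply: fit_s; rewrite size_rem // -sz_s.
Qed.

(** Numbers the five equality patterns of three letters. By [pat_perm] they classify triples up to
    permutations of the alphabet. *)
Definition pat (T : eqType) (x x' y : T) : nat :=
  if x == x' then if x == y then 0 else 1
  else if x == y then 2 else if x' == y then 3 else 4.

Lemma pat_inj (T U : eqType) (f : T -> U) (x x' y : T) :
  injective f -> pat (f x) (f x') (f y) = pat x x' y.
Proof. by move=> inj_f; rewrite /pat !inj_eq. Qed.

Lemma pat_perm (T : finType) (x x' y z z' t : T) :
  pat x x' y = pat z z' t ->
  exists p : {perm T}, [/\ p x = z, p x' = z' & p y = t].
Proof.
move=> eq_pat.
have [eq1 eq2 eq3] : [/\ (x == x') = (z == z'), (x == y) = (z == t)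
    & (x' == y) = (z' == t)].
  move: eq_pat; rewrite /pat.
  case: (x =P x'); case: (z =P z'); case: (x =P y); case: (z =P t);
    by case: (x' =P y); case: (z' =P t) => *; split; congruence.
(* Three transpositions send [x], [x'] and [y] in turn to their targets; equal patterns ensure that
   the targets already reached stay fixed. *)
pose p1 := tperm x z; pose p2 := tperm (p1 x') z'.
have p1x : p1 x = z by rewrite tpermL.
have p12x' : p2 (p1 x') = z' by rewrite tpermL.
have p12x : p2 (p1 x) = z.
  rewrite p1x /p2 -p1x; case: (eqVneq x x') => [xx'|ne].
    have /eqP <- : z == z' by rewrite -eq1 xx'.
    by rewrite -xx' p1x tpermL.
  rewrite tpermD //; first by rewrite (inj_eq perm_inj) eq_sym.
  by rewrite p1x eq_sym -eq1.
exists (p1 * p2 * tperm (p2 (p1 y)) t)%g; rewrite !permM tpermL p12x p12x'.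
have fixed w (w' : T) : (w == y) = (w' == t) -> p2 (p1 w) = w' ->
    tperm (p2 (p1 y)) t w' = w'.
  move=> eq_w def_w'.
  case: (eqVneq w y) eq_w => [wy /esym/eqP e|ne /esym/negbT ne'].
    by rewrite -wy def_w' e tpermL.
  rewrite tpermD //; last by rewrite eq_sym.
  by rewrite -def_w' !(inj_eq perm_inj) eq_sym.
by split=> //; [apply: (fixed x) | apply: (fixed x')].
Qed.

Definition relabel (s : {perm 'I_4}) (p : 'I_4 -> {perm 'I_3}) (e : clause) :
    clause :=
  [tuple p al (question e (s al)) | al < 4].

Lemma question_relabel s p e al :
  question (relabel s p e) al = p al (question e (s al)).
Proof. exact: tnth_mktuple. Qed.

Lemma track_relabel s p al w :
  track al (map (relabel s p) w) = map (p al) (track (s al) w).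
Proof.
by rewrite /track -!map_comp; apply: eq_map => e /=; rewrite question_relabel.
Qed.

Lemma relabelK s p :
  cancel (relabel s p) (relabel s^-1%g (fun al => (p (s^-1%g al))^-1%g)).
Proof.
move=> e; apply: eq_from_tnth => al.
by rewrite -!/(question _ al) !question_relabel permK permKV.
Qed.

Lemma realizable_relabel s p A B :
  realizable A B -> realizable (map (relabel s p) A) (map (relabel s p) B).
Proof.
move=> [w [wA wB red_w]]; exists (map (relabel s p) w).
split=> [||al]; rewrite ?alternate_map ?perm_map //.
by rewrite track_relabel; apply: reduces_map.
Qed.

Lemma critical_relabel s p A B :
  critical A B -> critical (map (relabel s p) A) (map (relabel s p) B).
Proof.
move=> [mAB notAB IH]; split=> [al|real|A' B'].
- by rewrite !track_relabel perm_map.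
- apply: notAB.
  have := realizable_relabel s^-1%g (fun al => (p (s^-1%g al))^-1%g) real.
  by rewrite -!map_comp !(eq_map (relabelK s p)) !map_id.
by rewrite size_map; apply: IH.
Qed.

Definition profile (a a' b : clause) : 4.-tuple nat :=
  [tuple pat (question a al) (question a' al) (question b al) | al < 4].

Lemma relabel_onto a a' b x x' y :
  perm_eq (profile x x' y) (profile a a' b) ->
  exists s p, [/\ relabel s p a = x, relabel s p a' = x' & relabel s p b = y].
Proof.
case/tuple_permP=> s prof_s.
have pat_s al : pat (question a (s al)) (question a' (s al)) (question b (s al))
    = pat (question x al) (question x' al) (question y al).
  have := congr1 (fun r => nth 0 r al) prof_s.
  by rewrite -!tnth_nth !tnth_mktuple.
have /fin_all_exists[p pP] := fun al => pat_perm (pat_s al).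
exists s, p; split; apply: eq_from_tnth => al;
  by rewrite -!/(question _ al) question_relabel; case: (pP al).
Qed.

(** * The search *)

Definition letters : seq nat := [:: 0; 1; 2].
Definition players : seq nat := [:: 0; 1; 2; 3].

(* The search handles clauses as lists of four numbers below 3, on which the
   kernel computes fast. *)
Definition code (e : clause) : seq nat := [seq val j | j <- tval e].

Lemma code_inj : injective code.
Proof. by move=> e f /(inj_map val_inj)/val_inj. Qed.

Lemma size_code e : size (code e) = 4.
Proof. by rewrite size_map size_tuple. Qed.

Lemma nth_code e (al : 'I_4) : nth 0 (code e) al = question e al.
Proof. by rewrite (nth_map ord0) ?size_tuple // -tnth_nth. Qed.

Definition letters_at (i : nat) (X : seq (seq nat)) : seq nat :=
  [seq nth 0 x i | x <- X].

Lemma letters_at_code (al : 'I_4) X :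
  letters_at al (map code X) = map val (track al X).
Proof.
rewrite /letters_at /track -!map_comp; apply: eq_map => e /=.
by rewrite nth_code.
Qed.

(* A product of four sets of letters, given by their indicators. *)
Definition box := seq (seq bool).

Fixpoint inbox (C : box) (x : seq nat) : bool :=
  match C, x with
  | r :: C', l :: x' => if nth false r l then inbox C' x' else false
  | _, _ => true
  end.

(** An element of this box would complete [X] so that it absorbs [Y]; one of [room] could be
    absorbed by [X] along with [Y]. Both are products because absorption is tested player by
    player. *)
Definition needed (X Y : seq (seq nat)) : box :=
  [seq [seq fits (letters_at i Y) (l :: letters_at i X) | l <- letters]
     | i <- players].

Definition room (X Y : seq (seq nat)) : box :=
  [seq [seq fits (l :: letters_at i Y) (letters_at i X) | l <- letters]
     | i <- players].

Lemma inboxP (F : nat -> nat -> bool) e :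
  inbox [seq [seq F i l | l <- letters] | i <- players] (code e) ->
  forall al : 'I_4, F al (question e al).
Proof.
move=> in_e al; rewrite -nth_code.
have: all (gtn 3) (code e) by apply/allP=> _ /mapP[j _ ->]; apply: ltn_ord.
case: (code e) (size_code e) in_e => [|l0 [|l1 [|l2 [|l3 [|//]]]]] //= _.
have row i l : l < 3 -> nth false [:: F i 0; F i 1; F i 2] l = F i l.
  by case: l => [|[|[|]]].
move=> in_e /and5P[lt0 lt1 lt2 lt3 _].
move: in_e; rewrite !row //; case F0: (F 0 l0) => //; case F1: (F 1 l1) => //.
case F2: (F 2 l2) => //; case F3: (F 3 l3) => // _.
by case: al => [[|[|[|[|//]]]] lt_al].
Qed.

Lemma lift_code (A : seq clause) X :
  {subset X <= map code A} -> exists2 X', X = map code X' & {subset X' <= A}.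
Proof.
elim: X => [|x X IHX] sXA; first by exists [::].
have [X' -> sX'A] := IHX (fun y yX => sXA y (mem_behead (s := x :: X) yX)).
have /mapP[e eA ->] : x \in map code A by rewrite sXA ?mem_head.
by exists (e :: X') => // f; rewrite inE => /predU1P[->|/sX'A].
Qed.

Lemma critical_absorb_code A B X Y :
    critical A B -> uniq X -> {subset X <= map code A} ->
    uniq Y -> {subset Y <= map code B} ->
    size X = (size Y).+1 -> 0 < size Y <= 2 ->
  ~ forall al : 'I_4, fits (letters_at al Y) (letters_at al X).
Proof.
move=> critAB uX /lift_code[X' defX sX'A] uY /lift_code[Y' defY sY'B].
move: uX uY; rewrite {}defX {}defY !size_map.
move=> /map_uniq uX' /map_uniq uY' szX szY fitYX.
apply: critical_absorb critAB uX' sX'A uY' sY'B szX szY _ => al.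
by have := fitYX al; rewrite !letters_at_code fits_map //; apply: val_inj.
Qed.

Lemma needed_critical A B X Y y :
    critical A B -> uniq (y :: X) -> {subset y :: X <= map code A} ->
    uniq Y -> {subset Y <= map code B} -> size X = size Y -> 0 < size Y <= 2 ->
  ~~ inbox (needed X Y) y.
Proof.
move=> critAB uX sXA uY sYB szX szY; apply/negP=> in_y.
have /mapP[e _ def_y] : y \in map code A by rewrite sXA ?mem_head.
apply: critical_absorb_code critAB uX sXA uY sYB _ szY _ => [|al].
  by rewrite /= szX.
rewrite def_y in in_y; rewrite def_y /= nth_code.
exact: (inboxP (F := fun i l => fits (letters_at i Y) (l :: letters_at i X))).
Qed.

Lemma room_critical A B X Y y :
    critical A B -> uniq X -> {subset X <= map code A} ->
    uniq (y :: Y) -> {subset y :: Y <= map code B} ->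
    size X = (size Y).+2 -> size Y <= 1 ->
  ~~ inbox (room X Y) y.
Proof.
move=> critAB uX sXA uY sYB szX szY; apply/negP=> in_y.
have /mapP[e _ def_y] : y \in map code B by rewrite sYB ?mem_head.
apply: critical_absorb_code critAB uX sXA uY sYB szX szY _ => al.
rewrite def_y in in_y; rewrite def_y [letters_at al (_ :: _)]/= nth_code.
exact: (inboxP (F := fun i l => fits (l :: letters_at i Y) (letters_at i X))).
Qed.

Fixpoint subseqs T (m : nat) (s : seq T) : seq (seq T) :=
  match m, s with
  | 0, _ => [:: [::]]
  | _, [::] => [::]
  | m'.+1, x :: s' => [seq x :: p | p <- subseqs m' s'] ++ subseqs m s'
  end.

Lemma subseqsP (T : eqType) m (s p : seq T) :
  p \in subseqs m s -> subseq p s /\ size p = m.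
Proof.
elim: s m p => [|x s IHs] [|m] p //=; rewrite ?inE; try by move/eqP->.
rewrite mem_cat => /orP[/mapP[r /IHs[sub_r <-] ->]|/IHs[sub_p <-]].
  by rewrite /= eqxx.
by split=> //; apply: subseq_trans sub_p (subseq_cons _ _).
Qed.

Section Search.

(* [excl a a' b] is expected to hold only of triples such that no critical pair
   has [a] and [a'] on one side and [b] on the other. *)
Variable excl : seq nat -> seq nat -> seq nat -> bool.

(* The boxes of elements that, together with [k], [s] on their own side and [t]
   on the opposite side, allow an absorption that involves [k]. *)
Definition own_boxes k (s t : seq (seq nat)) : seq box :=
  [seq needed [:: k] Y | Y <- subseqs 1 t]
  ++ [seq needed (k :: X) Y | X <- subseqs 1 s, Y <- subseqs 2 t]
  ++ [seq room X [:: k] | X <- subseqs 3 t].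

(** The new element is on the side of [t] here. It can be absorbed or absorbing, with two elements
    against one or three against two. *)
Definition opp_boxes k (s t : seq (seq nat)) : seq box :=
  [seq room (k :: X) [::] | X <- subseqs 1 s]
  ++ [seq needed X [:: k] | X <- subseqs 1 t]
  ++ [seq room (k :: X) Y | X <- subseqs 2 s, Y <- subseqs 1 t]
  ++ [seq needed X (k :: Y) | X <- subseqs 2 t, Y <- subseqs 1 s].

Definition inhabited_box (C : box) := all (has id) C.

Definition own_filter k s t ps :=
  let Cs := filter inhabited_box (own_boxes k s t) in
  [seq y <- ps | ~~ (has (inbox^~ y) Cs || has (excl k y) t)].

(** The lists [k :: s] and [y :: t] include the element itself because a triple with [a = a']
    encodes an excluded pair. *)
Definition opp_filter k s t pt :=
  let Cs := filter inhabited_box (opp_boxes k s t) in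
  [seq y <- pt | ~~ [|| y == k, has (inbox^~ y) Cs, has (excl k ^~ y) (k :: s)
                      | has (excl y ^~ k) (y :: t)]].

(* The arguments of a search are the elements known to be in the two sides and
   the lists of the remaining candidates. *)
Definition search :=
  seq (seq nat) -> seq (seq nat) -> seq (seq nat) -> seq (seq nat) -> bool.

Fixpoint branch (rec : search) (ch s t ps pt : seq (seq nat)) : bool :=
  if ch is k :: ch' then
    let ps' := [seq y <- ps | y != k] in
    [&& k \in ps, rec (k :: s) t (own_filter k s t ps') (opp_filter k s t pt)
      & branch rec ch' s t ps' pt]
  else true.

Fixpoint hits (U : box) (x : seq nat) : nat :=
  match U, x with
  | r :: U', l :: x' => if nth false r l then (hits U' x').+1 else hits U' x'
  | _, _ => 0
  end.

(* The average number of hits in [U] is the same on both sides. A cut [(U, c)]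
   is admissible if the known elements of the first side have at least [c] hits
   and those of the second side at most [c]; if one of them does not have
   exactly [c] hits, then there must be some other element that has less than
   [c] hits in the first side or more than [c] hits in the second one. *)
Definition cut := (box * nat)%type.

Definition strict_cut (s t : seq (seq nat)) (uc : cut) :=
  has (fun a => uc.2 < hits uc.1 a) s || has (fun b => hits uc.1 b < uc.2) t.

(* The part of the budget [b] that is left after one unit is spent on each
   element that satisfies [p]. *)
Fixpoint spend T (p : pred T) (s : seq T) (b : nat) : option nat :=
  if s is x :: s' then
    if p x then if b is b'.+1 then spend p s' b' else None else spend p s' b
  else Some b.

(* The cut in [cs] that leaves the fewest candidates. Nothing has to be proved
   about it, because [refute] checks the cut that it returns. *)
Fixpoint best_cut (s t ps pt : seq (seq nat)) (cs : seq cut) (b : nat)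
    (best : cut) : cut :=
  if cs is (u, c) :: cs' then
    let continue := best_cut s t ps pt cs' in
    if spend (fun y => hits u y < c) ps b is Some r then
    if spend (fun y => c < hits u y) pt r is Some r' then
    if strict_cut s t (u, c) then
      (* [b - r'] candidates are left; a later cut must leave strictly fewer. *)
      if b - r' is b'.+1 then continue b' (u, c) else (u, c)
    else continue b best else continue b best else continue b best
  else best.

(** The first branching removes the candidates below the threshold, so the second may drop them.
    Each added element also discards the cuts that it makes inadmissible. The default cut [([::],
    0)] is never strict, so the search fails if no cut applies. *)
Fixpoint refute (n : nat) (cs : seq cut) : search := fun s t ps pt =>
  if n is n'.+1 then
    let uc := best_cut s t ps pt cs (size ps + size pt) ([::], 0) in
    let w := hits uc.1 in let c := uc.2 in
    [&& all (fun a => c <= w a) s, all (fun b => w b <= c) t,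
        strict_cut s t uc,
        branch (fun s t =>
            refute n' [seq v <- cs | v.2 <= hits v.1 (head [::] s)] s t)
          [seq y <- ps | w y < c] s t ps pt
      & branch (fun t s pt ps =>
            refute n' [seq v <- cs | hits v.1 (head [::] t) <= v.2] s t ps pt)
          [seq y <- pt | c < w y] t s pt [seq y <- ps | c <= w y]]
  else false.

Fixpoint refute_right n cs (k1 : seq (seq nat)) : search := fun s t ps pt =>
  if k1 is k :: k1' then
    branch (fun t s pt ps =>
        refute_right n [seq v <- cs | hits v.1 (head [::] t) <= v.2] k1'
          s t ps pt)
      [:: k] t s pt ps
  else refute n cs s t ps pt.

Fixpoint refute_with n cs (k0 k1 : seq (seq nat)) : search := fun s t ps pt =>
  if k0 is k :: k0' then
    branch (fun s t =>
        refute_with n [seq v <- cs | v.2 <= hits v.1 (head [::] s)] k0' k1 s t)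
      [:: k] s t ps pt
  else refute_right n cs k1 s t ps pt.

(** * Soundness of the search *)

Definition excludes := forall A B, critical A B -> forall a a' b,
  a \in A -> a' \in A -> b \in B -> ~~ excl (code a) (code a') (code b).

Hypothesis exclP : excludes.

Lemma excl_critical A B a a' b :
    critical A B -> a \in map code A -> a' \in map code A -> b \in map code B ->
  excl a a' b = false.
Proof.
move=> critAB /mapP[e eA ->] /mapP[e' e'A ->] /mapP[f fB ->].
by apply/negbTE; apply: exclP critAB _ _ _ eA e'A fB.
Qed.

Definition bracket (X s ps : seq (seq nat)) :=
  [/\ {subset s <= X}, {subset X <= s ++ ps} & uniq (s ++ ps)].

Lemma bracket_filter (p : pred (seq nat)) X s ps :
    bracket X s ps -> (forall y, y \in X -> y \in ps -> p y) ->
  bracket X s (filter p ps).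
Proof.
move=> [sX Xps uniq_ps] pX; split=> // [y yX|].
  have := Xps y yX; rewrite !mem_cat mem_filter => /orP[->//|ps_y].
  by rewrite ps_y pX ?orbT.
by apply: subseq_uniq uniq_ps; rewrite cat_subseq ?filter_subseq.
Qed.

Lemma bracket_cons X s ps k : k \in X -> k \in ps ->
  bracket X s ps -> bracket X (k :: s) [seq y <- ps | y != k].
Proof.
move=> kX ps_k [sX Xps uniq_ps]; split=> [y|y yX|].
- by rewrite inE => /predU1P[->|/sX].
- have := Xps y yX; rewrite /= inE !mem_cat mem_filter.
  by case: eqP => //= _; case/orP=> ->; rewrite ?orbT.
have uniq_s : uniq ps by move: uniq_ps; rewrite cat_uniq => /and3P[].
have /perm_uniq -> // : perm_eq (k :: s ++ [seq y <- ps | y != k]) (s ++ ps).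
by rewrite -cat1s perm_catCA perm_cat2l /= -rem_filter // perm_sym perm_to_rem.
Qed.

Lemma own_filter_bracket A B k s t ps :
    critical A B -> bracket (map code A) (k :: s) ps ->
    {subset t <= map code B} -> uniq t ->
  bracket (map code A) (k :: s) (own_filter k s t ps).
Proof.
move=> critAB brA tB uniq_t; apply: bracket_filter (brA) _ => y yA ps_y.
have [ksA _ uniq_ksps] := brA.
have uniq_yks : uniq (y :: k :: s).
  move: uniq_ksps; rewrite cat_uniq cons_uniq.
  move=> /and3P[-> /hasPn/(_ y ps_y) /= yks _].
  by rewrite andbT.
have yksA : {subset y :: k :: s <= map code A}.
  by move=> z; rewrite inE => /predU1P[->|/ksA].
have sub_own X : subseq X s ->
    uniq (y :: k :: X) /\ {subset y :: k :: X <= map code A}.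
  move=> sXs; have sub : subseq (y :: k :: X) (y :: k :: s) by rewrite /= !eqxx.
  split; first exact: subseq_uniq sub uniq_yks.
  by move=> z /(mem_subseq sub)/yksA.
have sub_opp Y : subseq Y t -> uniq Y /\ {subset Y <= map code B}.
  move=> sYt; split=> [|z /(mem_subseq sYt)/tB //].
  exact: subseq_uniq uniq_t.
rewrite negb_or; apply/andP; split; apply/hasPn.
  move=> C; rewrite mem_filter !mem_cat => /andP[_ /or3P[]].
  - case/mapP=> Y /subseqsP[/sub_opp[uY sYB] szY] ->.
    have [u1 s1] := sub_own [::] (sub0seq _).
    by apply: needed_critical critAB _ _ uY sYB _ _; rewrite ?szY.
  - case/allpairsP=> -[X Y] [/subseqsP[/sub_own[uX sXA] szX]].
    move=> /subseqsP[/sub_opp[uY sYB] szY] ->.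
    by apply: needed_critical critAB uX sXA uY sYB _ _; rewrite /= ?szX szY.
  case/mapP=> X /subseqsP[/sub_opp[uX sXB] szX] ->.
  have [u1 s1] := sub_own [::] (sub0seq _).
  by apply: room_critical (critical_sym critAB) uX sXB u1 s1 _ _.
move=> b bt; rewrite (excl_critical critAB) //; last exact: tB.
by rewrite ksA ?mem_head.
Qed.

Lemma opp_filter_bracket A B k s t pt :
    critical A B -> {subset k :: s <= map code A} -> uniq (k :: s) ->
    bracket (map code B) t pt ->
  bracket (map code B) t (opp_filter k s t pt).
Proof.
move=> critAB ksA uniq_ks brB; apply: bracket_filter (brB) _ => y yB pt_y.
have [tB _ uniq_tpt] := brB.
have uniq_yt : uniq (y :: t).
  by move: uniq_tpt; rewrite cat_uniq /= => /and3P[-> /hasPn/(_ y pt_y) ->].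
have ytB : {subset y :: t <= map code B}.
  by move=> z; rewrite inE => /predU1P[->|/tB].
have sub_own X : subseq X s -> uniq (k :: X) /\ {subset k :: X <= map code A}.
  move=> sXs; have sub : subseq (k :: X) (k :: s) by rewrite /= eqxx.
  split; first exact: subseq_uniq sub uniq_ks.
  by move=> z /(mem_subseq sub)/ksA.
have sub_opp Y : subseq Y t -> uniq (y :: Y) /\ {subset y :: Y <= map code B}.
  move=> sYt; have sub : subseq (y :: Y) (y :: t) by rewrite /= eqxx.
  split; first exact: subseq_uniq sub uniq_yt.
  by move=> z /(mem_subseq sub)/ytB.
have critBA := critical_sym critAB.
have kA : k \in map code A by rewrite ksA ?mem_head.
have boxes : ~~ has (inbox^~ y) [seq C <- opp_boxes k s t | inhabited_box C].
  apply/hasPn=> C; rewrite mem_filter !mem_cat => /andP[_ /or4P[]].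
  - case/mapP=> X /subseqsP[/sub_own[uX sXA] szX] ->.
    have [u1 s1] := sub_opp [::] (sub0seq _).
    by apply: room_critical critAB uX sXA u1 s1 _ _; rewrite /= ?szX.
  - case/mapP=> X /subseqsP[/sub_opp[uX sXB] szX] ->.
    have [u1 s1] := sub_own [::] (sub0seq _).
    by apply: needed_critical critBA uX sXB u1 s1 _ _; rewrite /= ?szX.
  - case/allpairsP=> -[X Y] [/subseqsP[/sub_own[uX sXA] szX]].
    move=> /subseqsP[/sub_opp[uY sYB] szY] ->.
    by apply: room_critical critAB uX sXA uY sYB _ _; rewrite /= ?szX szY.
  case/allpairsP=> -[X Y] [/subseqsP[/sub_opp[uX sXB] szX]].
  move=> /subseqsP[/sub_own[uY sYA] szY] ->.
  by apply: needed_critical critBA uX sXB uY sYA _ _; rewrite /= ?szX szY.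
rewrite 3!negb_or; apply/and4P; split.
- apply/negP=> /eqP yk; rewrite yk in yB.
  case/mapP: kA yB => e eA -> /mapP[f fB /code_inj ef].
  by rewrite -ef in fB; apply: critical_disjoint critAB eA fB.
- exact: boxes.
- apply/hasPn=> x xks; rewrite (excl_critical critAB) //; exact: ksA.
by apply/hasPn=> z zyt; rewrite (excl_critical critBA) //; apply: ytB.
Qed.

Lemma branchP A B (rec : search) ch s t ps pt :
    critical A B ->
    (forall s' t' ps' pt', rec s' t' ps' pt' -> bracket (map code A) s' ps' ->
      bracket (map code B) t' pt' -> False) ->
    branch rec ch s t ps pt ->
    bracket (map code A) s ps -> bracket (map code B) t pt ->
  {in ch, forall k, k \notin map code A}.
Proof.
move=> critAB recP; elim: ch ps => [//|k ch IHch] ps /=.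
move=> /and3P[ps_k rec_k branch_ch] brA brB.
have notAk : k \notin map code A.
  apply/negP=> kA; apply: recP rec_k _ _.
    apply: own_filter_bracket critAB (bracket_cons kA ps_k brA) _ _.
      by case: brB.
    by case: brB => _ _; rewrite cat_uniq => /and3P[].
  have [ksA _] := bracket_cons kA ps_k brA.
  rewrite cat_uniq => /and3P[uniq_ks _ _].
  exact: opp_filter_bracket critAB ksA uniq_ks brB.
move=> x; rewrite inE => /predU1P[->//|ch_x].
apply: IHch branch_ch _ brB x ch_x.
by apply: bracket_filter brA _ => y yA _; apply: contraNneq notAk => <-.
Qed.

(** Each term depends on the letter of one player, so the total over a multiset is determined by its
    marginals. *)
Lemma hitsE U x :
  hits U x = \sum_(i < size x) nth false (nth [::] U i) (nth 0 x i).
Proof.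
elim: x U => [|l x IHx] [|r U]; rewrite /= ?big_ord0 //.
  by rewrite big1 // => i _; rewrite !nth_nil.
by rewrite big_ord_recl /= IHx; case: (nth false r l).
Qed.

Lemma sum_hits A B U :
  equimarginal A B ->
  \sum_(x <- map code A) hits U x = \sum_(y <- map code B) hits U y.
Proof.
move=> mAB.
have sumE D : \sum_(x <- map code D) hits U x
    = \sum_(al < 4) \sum_(j <- track al D) nth false (nth [::] U al) j.
  rewrite big_map; transitivity (\sum_(e <- D) \sum_(al < 4)
      nth false (nth [::] U al) (question e al)).
    apply: eq_bigr => e _; rewrite hitsE size_code.
    by apply: eq_bigr => al _; rewrite nth_code.
  by rewrite exchange_big /=; apply: eq_bigr => al _; rewrite big_map.
by rewrite !sumE; apply: eq_bigr => al _; apply: perm_big.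
Qed.

(** Sizes and totals of hits agree on both sides, so the excess over [c] in [A] plus the deficit in
    [B] is zero. *)
Lemma cut_exact A B U c :
    equimarginal A B -> {in map code A, forall x, c <= hits U x} ->
    {in map code B, forall y, hits U y <= c} ->
  {in map code A ++ map code B, forall x, hits U x = c}.
Proof.
move=> mAB geA leB.
have sumA : \sum_(x <- map code A) hits U x
    = size A * c + \sum_(x <- map code A) (hits U x - c).
  rewrite -(size_map code) -sum1_size big_distrl -big_split /=.
  rewrite big_seq_cond [RHS]big_seq_cond.
  by apply: eq_bigr => x /andP[xA _]; rewrite mul1n subnKC ?geA.
have sumB : size B * c = \sum_(y <- map code B) hits U y
    + \sum_(y <- map code B) (c - hits U y).
  rewrite -(size_map code) -sum1_size big_distrl -big_split /=.
  rewrite big_seq_cond [RHS]big_seq_cond.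
  by apply: eq_bigr => y /andP[yB _]; rewrite mul1n subnKC ?leB.
have /eqP : \sum_(x <- map code A) (hits U x - c)
    + \sum_(y <- map code B) (c - hits U y) = 0.
  have := sum_hits U mAB; have := equimarginal_size mAB; nia.
rewrite addn_eq0 !sum_nat_seq_eq0 => /andP[/allP eqA /allP eqB] x.
rewrite mem_cat => /orP[xA|xB]; apply/eqP; rewrite eqn_leq.
  by rewrite geA // andbT -subn_eq0; apply: eqA.
by rewrite leB //= -subn_eq0; apply: eqB.
Qed.

Lemma refuteP A B n cs s t ps pt :
    critical A B -> refute n cs s t ps pt ->
    bracket (map code A) s ps -> ~ bracket (map code B) t pt.
Proof.
move=> critAB; elim: n cs s t ps pt => [//|n IHn] cs s t ps pt.
rewrite /=; set uc := best_cut _ _ _ _ _ _ _.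
case/and5P=> /allP geS /allP leT strict_uc brS brT brA brB.
have geA : {in map code A, forall x, uc.2 <= hits uc.1 x}.
  move=> x xA; have [_ /(_ x xA) + _] := brA.
  rewrite mem_cat => /orP[/geS//|ps_x].
  rewrite leqNgt; apply/negP=> lt_x.
  have := branchP critAB (fun s t => IHn _ s t) brS brA brB (x := x).
  by rewrite mem_filter lt_x xA => /(_ ps_x).
have brA' : bracket (map code A) s [seq y <- ps | uc.2 <= hits uc.1 y].
  by apply: bracket_filter brA _ => y yA _; apply: geA.
have leB : {in map code B, forall y, hits uc.1 y <= uc.2}.
  move=> y yB; have [_ /(_ y yB) + _] := brB.
  rewrite mem_cat => /orP[/leT//|pt_y].
  rewrite leqNgt; apply/negP=> gt_y.
  have := branchP (critical_sym critAB)
    (fun t s pt ps r brB brA => IHn _ s t ps pt r brA brB)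
    brT brB brA' (x := y).
  by rewrite mem_filter gt_y yB => /(_ pt_y).
have [mAB _ _] := critAB; have exact_uc := cut_exact mAB geA leB.
case/orP: strict_uc => /hasP[x].
  case: brA => sub _ _ /sub xA; rewrite exact_uc ?ltnn //.
  by rewrite mem_cat xA.
case: brB => sub _ _ /sub xB; rewrite exact_uc ?ltnn //.
by rewrite mem_cat xB orbT.
Qed.

Lemma refute_withP A B n cs k0 k1 s t ps pt :
    critical A B -> {subset k0 <= map code A} -> {subset k1 <= map code B} ->
    refute_with n cs k0 k1 s t ps pt ->
    bracket (map code A) s ps -> ~ bracket (map code B) t pt.
Proof.
move=> critAB; elim: k0 cs s t ps pt => [|k k0 IHk0] cs s t ps pt kA kB.
  elim: k1 kB cs s t ps pt => [|k k1 IHk1] kB cs s t ps pt.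
    exact: refuteP critAB.
  have k1B : {subset k1 <= map code B}.
    by move=> x k1x; apply: kB; rewrite inE k1x orbT.
  move=> br brA brB.
  have := branchP (critical_sym critAB)
    (rec := fun t s pt ps =>
      refute_right n [seq v <- cs | hits v.1 (head [::] t) <= v.2] k1 s t ps pt)
    (fun t s pt ps r brB brA => IHk1 k1B _ s t ps pt r brA brB)
    br brB brA (mem_head _ _).
  by rewrite kB ?mem_head.
have k0A : {subset k0 <= map code A}.
  by move=> x k0x; apply: kA; rewrite inE k0x orbT.
move=> br brA brB.
have := branchP critAB
  (rec := fun s t =>
    refute_with n [seq v <- cs | v.2 <= hits v.1 (head [::] s)] k0 k1 s t)
  (fun s t ps pt => IHk0 _ s t ps pt k0A kB) br brA brB (mem_head _ _).
by rewrite kA ?mem_head.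
Qed.

End Search.

(** * The three refutations *)

Fixpoint words T (s : seq T) (n : nat) : seq (seq T) :=
  if n is n'.+1 then [seq x :: w | x <- s, w <- words s n'] else [:: [::]].

Lemma mem_words (T : eqType) (s w : seq T) :
  {subset w <= s} -> w \in words s (size w).
Proof.
elim: w => [//|x w IHw] sws; apply: allpairs_f; first by rewrite sws ?mem_head.
by apply: IHw => y yw; rewrite sws // inE yw orbT.
Qed.

Definition codes : seq (seq nat) := words letters 4.

(* The set of all three letters is left out, as it would only shift the
   threshold. *)
Definition cuts (m : nat) : seq cut :=
  let sets := [seq r <- words [:: false; true] 3 | ~~ all id r] in
  [seq (U, c) | U <- [seq U <- words sets 4 | count (has id) U <= m],
                c <- iota 0 5].

(** [m] bounds the number of players that a cut involves, and 20 the depth of nested cuts. *)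
Definition refutes excl m k0 k1 : bool :=
  refute_with excl 20 (cuts m) k0 k1 [::] [::] codes codes.

Definition columns (a a' b : seq nat) : seq nat :=
  [seq pat z.1.1 z.1.2 z.2 | z <- zip (zip a a') b].

Definition has_profile (l a a' b : seq nat) : bool := fits (columns a a' b) l.

Definition decode (l : seq nat) : clause := [tuple inord (nth 0 l al) | al < 4].

Lemma code_in_codes e : code e \in codes.
Proof.
rewrite /codes -(size_code e); apply: mem_words => _ /mapP[j _ ->].
by case: j => [[|[|[|]]]].
Qed.

Lemma decodeK l : l \in codes -> code (decode l) = l.
Proof.
move=> l_code.
have /allP/(_ l l_code)/andP[/eqP sz_l /allP lt_l] :
  all (fun l => (size l == 4) && all (gtn 3) l) codes by [].
apply: (@eq_from_nth _ 0) => [|i]; rewrite size_code ?sz_l // => lti.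
rewrite -[i]/(val (Ordinal lti)) nth_code /question tnth_mktuple inordK //.
by apply: lt_l; rewrite mem_nth ?sz_l.
Qed.

Lemma columns_code a a' b :
  columns (code a) (code a') (code b) = profile a a' b.
Proof.
apply: (@eq_from_nth _ 0) => [|i].
  by rewrite size_map !size_zip !size_code size_tuple.
rewrite size_map !size_zip !size_code => lti.
rewrite (nth_map (0, 0, 0)) ?size_zip ?size_code //.
rewrite !nth_zip ?size_zip ?size_code //=.
have -> : nth 0 (profile a a' b) i = tnth (profile a a' b) (Ordinal lti).
  by rewrite (tnth_nth 0).
rewrite tnth_mktuple -(pat_inj _ _ _ val_inj).
by congr pat; exact: (nth_code _ (Ordinal lti)).
Qed.

Lemma refutes_critical excl m A B k0 k1 :
    excludes excl -> critical A B -> refutes excl m k0 k1 ->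
  {subset k0 <= map code A} -> ~ {subset k1 <= map code B}.
Proof.
move=> exclP critAB ref k0A k1B.
have start C : bracket (map code C) [::] codes.
  by split=> // _ /mapP[e _ ->]; apply: code_in_codes.
exact: (refute_withP exclP critAB k0A k1B ref (start A) (start B)).
Qed.

(** A critical pair with a triple of this profile can be relabelled into one with [x], [x'] and [y],
    which the refutation rules out. [undup] serves the case [x = x'], as an element can be added
    only once. *)
Lemma has_profile_excludes excl m x x' y :
    all (mem codes) [:: x; x'; y] ->
    excludes excl -> refutes excl m (undup [:: x; x']) [:: y] ->
  excludes (has_profile (columns x x' y)).
Proof.
case/and4P=> /decodeK def_x /decodeK def_x' /decodeK def_y _.
move=> exclP ref A B critAB a a' b aA a'A bB; apply/negP.
rewrite /has_profile columns_code -def_x -def_x' -def_y columns_code.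
move=> /fits_perm; rewrite !size_tuple perm_sym => /(_ erefl).
case/relabel_onto=> s [p [sa sa' sb]].
apply: (refutes_critical exclP (critical_relabel s p critAB) ref) => z.
  rewrite mem_undup !inE => /orP[]/eqP->.
    by rewrite -def_x -sa !map_f.
  by rewrite -def_x' -sa' !map_f.
by rewrite inE => /eqP->; rewrite -def_y -sb !map_f.
Qed.

(* Each refutation excludes a configuration up to relabelling, and the next one
   prunes its search by it: without this, the refutation of [0000] would be far
   out of reach. *)
Lemma refutes_0111_0012 :
  refutes (fun _ _ _ => false) 3 [:: [:: 0; 0; 0; 0]; [:: 0; 1; 1; 1]]
    [:: [:: 0; 0; 1; 2]].
Proof. by vm_compute. Qed.

(** The entries are the column patterns of 0000 and 0111 against 0012. *)
Lemma excludes_0111_0012 : excludes (has_profile [:: 0; 2; 3; 4]).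
Proof.
exact: (@has_profile_excludes (fun _ _ _ => false) 3 [:: 0; 0; 0; 0]
  [:: 0; 1; 1; 1] [:: 0; 0; 1; 2] isT (fun _ _ _ _ _ _ _ _ _ => isT)
  refutes_0111_0012).
Qed.

Lemma refutes_0011 :
  refutes (has_profile [:: 0; 2; 3; 4]) 2 [:: [:: 0; 0; 0; 0]]
    [:: [:: 0; 0; 1; 1]].
Proof. by vm_compute. Qed.

(** The entries 0 and 1 force [a = a'] and mean agreement and disagreement with [b]: opposite
    clauses of a critical pair never agree for exactly two players. *)
Lemma excludes_0011 : excludes (has_profile [:: 0; 0; 1; 1]).
Proof.
exact: (@has_profile_excludes (has_profile [:: 0; 2; 3; 4]) 2 [:: 0; 0; 0; 0]
  [:: 0; 0; 0; 0] [:: 0; 0; 1; 1] isT excludes_0111_0012 refutes_0011).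
Qed.

Lemma refutes_0000 :
  refutes (has_profile [:: 0; 0; 1; 1]) 2 [:: [:: 0; 0; 0; 0]] [::].
Proof. by vm_compute. Qed.

Lemma not_critical A B : ~ critical A B.
Proof.
move=> critAB; have [mAB notAB _] := critAB.
case: A => [|a A] in critAB mAB notAB *.
  case: B => [|b B] in critAB mAB notAB *; last first.
    by have := equimarginal_size mAB.
  by apply: notAB; exists [::]; split=> // al; apply: reduces_nil.
(* Every clause can be relabelled to 0000, since [profile a a a] consists of zeros. *)
pose z := decode [:: 0; 0; 0; 0].
have [|s [p [sa _ _]]] := @relabel_onto a a a z z z.
  have -> // : profile z z z = profile a a a :> seq nat.
  by congr tval; apply: eq_from_tnth => al; rewrite !tnth_mktuple /pat !eqxx.
apply: (refutes_critical excludes_0011 (critical_relabel s p critAB)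
  refutes_0000) => // x.
rewrite inE => /eqP->; rewrite -(@decodeK [:: 0; 0; 0; 0]) // -/z -sa.
by rewrite !map_f ?mem_head.
Qed.

Lemma equimarginal_realizable A B : equimarginal A B -> realizable A B.
Proof.
have [n] := ubnP (size A); elim: n => // n IHn in A B * => ltAn mAB.
apply: NNPP => notAB; apply: (@not_critical A B); split=> // A' B' mA'B' ltA'A.
by apply: IHn => //; apply: leq_trans ltA'A _.
Qed.

(** * From kernel vectors to words *)

Definition positive_part (z : int) : nat := if z is Posz n then n else 0.

Lemma positive_partB (z : int) :
  ((positive_part z)%:R - (positive_part (- z))%:R = z :> int)%R.
Proof. by case: z => [[|n]|n]; rewrite /= ?subr0 ?sub0r ?natz. Qed.

Lemma positive_partD (z : int) : positive_part z + positive_part (- z) = `|z|%N.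
Proof. by case: z => [[|n]|n]; rewrite /= ?addn0. Qed.

Lemma alternating_sum (T : eqType) (x0 x : T) (s : seq T) :
  (\sum_(t < size s | nth x0 s t == x) (-1) ^+ t
    = (count_mem x (alternate true s))%:R - (count_mem x (alternate false s))%:R
    :> int)%R.
Proof.
elim: s => [|y s IHs] /=; first by rewrite big_ord0 subr0.
rewrite big_mkcond big_ord_recl /= -big_mkcond /=.
rewrite (eq_bigr (fun t : 'I_(size s) => - (-1) ^+ t)%R) => [|t _]; last first.
  by rewrite exprS mulN1r.
rewrite sumrN IHs natrD opprB.
by case: (y == x); rewrite ?expr0 ?mulr1n ?mulr0n ?add0r ?addrA.
Qed.

Section Circuit.
Variables (E : {set clause}) (c : {ffun clause_in E -> int}).

Definition copies (d : clause_in E -> int) : seq clause :=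
  flatten [seq nseq (positive_part (d e)) (val e)
             | e <- index_enum (clause_in E)].

Lemma count_copies d (P : pred clause) :
  count P (copies d) = \sum_e P (val e) * positive_part (d e).
Proof.
rewrite count_flatten sumnE !big_map.
by apply: eq_bigr => e _; rewrite count_nseq.
Qed.

Lemma kernel_sum al j : in_kerT c ->
  (\sum_(e : clause_in E) (question (val e) al == j)%:R * c e = 0 :> int)%R.
Proof.
move=> /matrixP/(_ (enum_rank (al, j)) ord0); rewrite !mxE => ker_c.
apply: etrans ker_c.
rewrite (reindex (fun i : 'I_#|clause_in E| => enum_val i)) /=; last first.
  by exists enum_rank => e _; rewrite ?enum_valK ?enum_rankK.
by apply: eq_bigr => i _; rewrite !mxE enum_rankK.
Qed.

(** The kernel equation at column [(al, j)] balances the occurrences of [j] for player [al] in the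
    two parts. *)
Lemma kernel_equimarginal :
  in_kerT c -> equimarginal (copies c) (copies (fun e => - c e)%R).
Proof.
move=> ker_c al; apply/allP=> j _ /=; rewrite !count_map !count_copies.
rewrite -(Num.Theory.eqr_nat int) !natr_sum -subr_eq0 -sumrB.
rewrite -[X in _ == X](kernel_sum al j ker_c).
by apply/eqP/eq_bigr => e _; rewrite !natrM -mulrBr positive_partB.
Qed.

Lemma lift_word (w : seq clause) :
  {subset w <= E} -> exists w' : seq (clause_in E), map val w' = w.
Proof.
elim: w => [|x w IHw] swE; first by exists [::].
have [y yw|w' def_w] := IHw; first by rewrite swE // inE yw orbT.
by exists (Sub x (swE x (mem_head _ _)) :: w'); rewrite /= def_w.
Qed.

Lemma count_mem_copies d e :
  count_mem (val e) (copies d) = positive_part (d e).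
Proof.
rewrite count_copies (bigD1 e) //= eqxx mul1n big1 ?addn0 // => f.
by rewrite -val_eqE => /negPf /= ->.
Qed.

Lemma copies_sub d : {subset copies d <= E}.
Proof.
move=> x /flattenP[s /mapP[e _ ->]]; rewrite mem_nseq => /andP[_ /eqP->].
exact: valP.
Qed.

Lemma kernel_word : in_kerT c -> exists w : seq (clause_in E),
  [/\ balanced w, forall e, count_mem e w = `|c e|%N & alternating w = c].
Proof.
move=> /kernel_equimarginal/equimarginal_realizable[w [wA wB red_w]].
(* The induction may pass through clauses outside [E], but the letters of [w] itself come from
   [copies] and hence from [E]. *)
have [x|w' def_w] := @lift_word w.
  rewrite -has_pred1 has_count count_alternate addn_gt0 -!has_count !has_pred1.
  by rewrite (perm_mem wA) (perm_mem wB) => /orP[]/copies_sub.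
have count_w' b e :
    count_mem e (alternate b w') = count_mem (val e) (alternate b w).
  rewrite -def_w alternate_map count_map.
  by apply: eq_count => f /=; rewrite val_eqE.
have countA e : count_mem e (alternate true w') = positive_part (c e).
  by rewrite count_w' (seq.permP wA) count_mem_copies.
have countB e : count_mem e (alternate false w') = positive_part (- c e)%R.
  by rewrite count_w' (seq.permP wB) count_mem_copies.
exists w'; split=> [al|e|].
- by have := red_w al; rewrite /track -def_w -map_comp.
- by rewrite count_alternate countA countB positive_partD.
apply/ffunP=> e; rewrite ffunE.
rewrite (eq_bigl (fun t : 'I_(size w') => nth e w' t == e)) => [|t]; last first.
  by rewrite (tnth_nth e).
by rewrite alternating_sum countA countB positive_partB.
Qed.

End Circuit.

Lemma natr_absz_F2 (z : int) : ((`|z|%N)%:R = z%:~R :> 'F_2)%R.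
Proof.
by case: z => n //; rewrite NegzE abszN /= mulrNz oppr_pchar2 // pchar_Fp.
Qed.

Local Open Scope ring_scope.

Theorem theorem3p1 (E : {set clause}) (c : {ffun clause_in E -> int})
    (hc : primitive_circuit c) :
  exists w : seq (clause_in E),
    [/\ balanced w,
        forall e : clause_in E, count_mem e w = `|c e|%N,
        alternating w = c \/ alternating w = - c
      & parity_vector w = mod2 c].
Proof.
case: hc => ker_c _ _ _; have [w [bal_w count_w alt_w]] := kernel_word ker_c.
exists w; split=> //; first by left.
by apply/ffunP=> e; rewrite !ffunE count_w natr_absz_F2.
Qed.
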